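(* Let $v\geq 2$ and $0\leq \Delta<v$ be integers and let $L\geq 0$ be an integer. Then \[ \sum_{m,k,n_1,\ldots,n_{v-1}\geq 0} q^{(m+k)^2+k^2+\Delta(m+2k)+\sum_{j=1}^{v-1}N_j^2+\sum_{t=v-\Delta}^{v-1}N_t}\binom{L}{m,\,2k+\Delta}_q {k-\sum_{t=1}^{v-2}N_t \brack n_{v-1}}_{q^2}\prod_{j=1}^{v-2}{n_j+2k-2\sum_{t=1}^{j}N_t+\min(\Delta,v-1-j) \brack n_j}_q \] \[ =\sum_{j=-\infty}^{\infty}(-1)^j q^{(2v+1)vj^2+(2v+1)\Delta j}{2L \brack L-\Delta-2vj}_q . \]
   Context: For integers $n\ge 0$, $(a;q)_n=\prod_{j=0}^{n-1}(1-aq^j)$ and $(q)_n=(q;q)_n$. For integers $m,n$, the $q$-binomial coefficient is ${n+m \brack n}_q=\frac{(q)_{n+m}}{(q)_n(q)_m}$ if $m,n\geq 0$ and $0$ otherwise; ${\cdot \brack \cdot}_{q^2}$ denotes the same with $q$ replaced by $q^2$. The $q$-trinomial is $\binom{L}{m,n}_q={L \brack m}_q{L-m \brack n}_q$. For summation variables $n_1,\ldots,n_{v-1}$, $N_j=\sum_{t=j}^{v-1}n_t$. Empty sums are $0$ and empty products are $1$. *)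

(* Defs.v *)
From mathcomp Require Import all_boot all_order all_algebra zify.
From mathcomp Require Import boolp classical_sets functions cardinality fsbigop.

Set Implicit Arguments.
Unset Strict Implicit.
Unset Printing Implicit Defensive.
Import Order.TTheory GRing.Theory Num.Theory.
Local Open Scope classical_set_scope.
Local Open Scope ring_scope.

Section QSeries.
Variable F : fieldType.
Implicit Type q : F.

Definition qpoch (a q : F) (n : nat) : F := \prod_(j < n) (1 - a * q ^+ j).

(* [a over b]_q; writing a = n + m and b = n, the condition 0 <= b <= a is
   m, n >= 0. *)
Definition qbin q (a b : int) : F :=
  if (0 <= b) && (b <= a) then
    qpoch q q `|a|%N / (qpoch q q `|b|%N * qpoch q q `|a - b|%N)
  else 0.

Definition qtrin q (L m n : int) : F := qbin q L m * qbin q (L - m) n.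

(* A tuple [tnth n 0; ...; tnth n (v-2)] stands for (n_1, ..., n_(v-1)):
   the summation variables are numbered from 1. *)
Definition nvar (v : nat) (n : v.-1.-tuple nat) (j : nat) : nat :=
  nth 0%N n j.-1.

Definition Nsum (v : nat) (n : v.-1.-tuple nat) (j : nat) : nat :=
  (\sum_(j <= t < v) nvar n t)%N.

Definition lhs_exponent (v Delta m k : nat) (n : v.-1.-tuple nat) : nat :=
  ((m + k) ^ 2 + k ^ 2 + Delta * (m + 2 * k)
   + \sum_(1 <= j < v) Nsum n j ^ 2 + \sum_(v - Delta <= t < v) Nsum n t)%N.

Definition lhs_term q (v Delta L : nat) (x : nat * nat * v.-1.-tuple nat) : F :=
  let: (m, k, n) := x in
  q ^+ lhs_exponent Delta m k n
  * qtrin q L%:Z m%:Z (2 * k + Delta)%N%:Z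
  * qbin (q ^+ 2) (k%:Z - (\sum_(1 <= t < v.-1) Nsum n t)%N%:Z)
      (nvar n v.-1)%:Z
  * \prod_(1 <= j < v.-1)
      qbin q ((nvar n j)%:Z + 2 * k%:Z
              - 2 * (\sum_(1 <= t < j.+1) Nsum n t)%N%:Z
              + (minn Delta (v - 1 - j))%:Z)
        (nvar n j)%:Z.

Definition rhs_term q (v Delta L : nat) (j : int) : F :=
  (-1) ^ j
  * q ^ ((2 * v%:Z + 1) * v%:Z * j ^+ 2 + (2 * v%:Z + 1) * Delta%:Z * j)
  * qbin q (2 * L%:Z) (L%:Z - Delta%:Z - 2 * v%:Z * j).

Lemma qbin_neq0 q (a b : int) : qbin q a b != 0 -> 0 <= b <= a.
Proof. by rewrite /qbin; case: ifP => //; rewrite eqxx. Qed.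

Lemma nvar_le_Nsum1 (v : nat) (n : v.-1.-tuple nat) (i : nat) :
  i \in (n : seq nat) -> (i <= Nsum n 1)%N.
Proof.
move=> ni; rewrite /Nsum.
have lti : (index i n < v.-1)%N by rewrite -{2}(size_tuple n) index_mem.
rewrite (big_cat_nat (n := (index i n).+1)) //=; last by lia.
rewrite [X in (_ + X)%N]big_ltn; last by lia.
by rewrite /nvar /= nth_index //; lia.
Qed.

(* \sum_(x \in A) is 0 by convention when the support is infinite; this lemma
   and the next show that the convention plays no role for the two sums. *)
Lemma finite_lhs_support q (v Delta L : nat) : (2 <= v)%N ->
  finite_set [set x | lhs_term q (v := v) Delta L x != 0].
Proof.
move=> v2; pose B := (L + L + v).+1.
pose T := ('I_B * 'I_B * v.-1.-tuple 'I_B)%type.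
pose f (x : T) : nat * nat * v.-1.-tuple nat :=
  (val x.1.1, val x.1.2, map_tuple val x.2).
apply: (@sub_finite_set _ _ (f @` [set: T])); last first.
  exact/finite_image/finite_finset.
move=> [[m k] n] /=; rewrite /qtrin !mulf_eq0 !negb_or -!andbA.
move=> /and5P[_ /qbin_neq0 h1 /qbin_neq0 h2 /qbin_neq0 h3 hp].
have N1 : (Nsum n 1 <= k + v)%N.
  case: (ltnP 2 v) => v3; last first.
    have {v3}Ev : v = 2%N by lia.
    by subst v; rewrite /Nsum big_nat1; move: h3; rewrite big_geq //=; lia.
  move: hp; rewrite big_ltn; last by lia.
  rewrite mulf_eq0 negb_or => /andP[/qbin_neq0 + _].
  by rewrite big_nat1; lia.
exists (inord m, inord k, map_tuple inord n) => //.
rewrite /f /= !inordK; [|by rewrite /B; lia..].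
congr (_, _, _); apply: val_inj => /=.
rewrite -map_comp -[RHS]map_id; apply/eq_in_map => i /nvar_le_Nsum1 hi /=.
by rewrite inordK // /B; lia.
Qed.

Lemma finite_rhs_support q (v Delta L : nat) : (2 <= v)%N ->
  finite_set [set j | rhs_term q v Delta L j != 0].
Proof.
move=> v2; pose B := (L + Delta).+1.
pose f (i : 'I_(B + B)) : int := (val i)%:Z - B%:Z.
apply: (@sub_finite_set _ _ (f @` [set: 'I_(B + B)])); last first.
  exact/finite_image/finite_finset.
move=> j /=; rewrite /rhs_term !mulf_eq0 !negb_or => /andP[_ /qbin_neq0 h].
have hj : `|j| <= L%:Z + Delta%:Z by nia.
have lt : (`|(j + B%:Z)%R| < B + B)%N by rewrite /B; lia.
by exists (Ordinal lt) => //; rewrite /f /= /B; lia.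
Qed.

End QSeries.

(* Main.v *)
Require Import Defs.
From mathcomp Require Import all_boot all_order all_algebra zify ring.
From mathcomp Require Import classical_sets fsbigop.

Set Implicit Arguments.
Unset Strict Implicit.
Unset Printing Implicit Defensive.
Import Order.TTheory GRing.Theory Num.Theory.
Local Open Scope classical_set_scope.
Local Open Scope ring_scope.

(** For fixed k, the sum over n_1, ..., n_(v-1) equals
      \sum_j (-1)^j q^(v j^2 - Delta j) [2k + Delta, k + v j]_q .
    Peeling off N_(v-1), N_(v-2), ... one at a time is an iterated Burge
    transform: each step sends a product of two q-binomial coefficients to
    another such product by the q-analogue of Nanjundiah's identity (a form of
    q-Pfaff-Saalschuetz), and the iteration starts from
      [n, l]_(q^2) = \sum_j (-1)^j q^(j^2) [n, l - j]_q [n, l + j]_q .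
    Once the inner sum has this form, the sum over m and k is evaluated term by
    term with two q-Vandermonde summations.  Negative powers of q occur on the
    way, so q = 0 is treated apart; there a single term survives on each side. *)

(** * Finitely supported sums as sums over finite types *)

Lemma fsum_inj (V : nmodType) (T : finType) (I : choiceType) (h : T -> I)
    (f : I -> V) :
  injective h -> (forall i, f i != 0 -> exists t, h t = i) ->
  \sum_(i \in [set: I]) f i = \sum_t f (h t).
Proof.
move=> hI hf; rewrite (fsbigE (map h (index_enum T))) //.
- by rewrite big_map; apply: eq_bigl => t; rewrite in_setT.
- by rewrite map_inj_uniq // index_enum_uniq.
- by move=> i _; apply: contraNeq => /hf[t <-]; rewrite map_f // mem_index_enum.
Qed.

Lemma fsum_range (V : nmodType) (f : int -> V) (a : int) (n : nat) :
  (forall j, f j != 0 -> a <= j < a + n%:Z) ->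
  \sum_(j \in [set: int]) f j = \sum_(t < n) f (a + t%:Z).
Proof.
move=> hf; apply: (fsum_inj (h := fun t : 'I_n => a + t%:Z)).
  by move=> s t /addrI[] /val_inj.
move=> j /hf /andP[h1 h2].
have lt : (`|j - a| < n)%N by lia.
by exists (Ordinal lt) => /=; lia.
Qed.

Lemma big_ord_supp (V : nmodType) (f : int -> V) (n n' : nat) :
  (forall j : int, 0 <= j -> f j != 0 -> j < n%:Z /\ j < n'%:Z) ->
  \sum_(t < n) f t%:Z = \sum_(t < n') f t%:Z.
Proof.
wlog le_n : n n' / (n <= n')%N => [hw|hf].
  case: (leqP n n') => [|/ltnW] h hf; first exact: hw.
  by apply/esym/hw => // j h0 /(hf _ h0)[].
rewrite -!(big_mkord xpredT (fun t => f t%:Z)) [RHS](big_cat_nat (n := n)) //=.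
rewrite [X in _ = _ + X]big1_seq ?addr0 // => t /andP[_].
rewrite mem_index_iota => /andP[h1 h2].
by apply/eqP/negPn/negP => /hf; lia.
Qed.

(** * Truncated sums over the integers *)

Section SumZ.
Variable R : comNzRingType.
Implicit Type f : int -> R.

(* The sum of f over the interval ]-B, B], folded by the involution j |-> 1 - j:
   antisymmetric sums then vanish term by term, also in characteristic 2. *)
Definition sumZ (B : nat) (f : int -> R) : R :=
  \sum_(t < B) (f (t%:Z + 1) + f (- t%:Z)).

Lemma eq_sumZ B f g : f =1 g -> sumZ B f = sumZ B g.
Proof. by move=> fg; apply: eq_bigr => t _; rewrite !fg. Qed.

Lemma sumZD B f g : sumZ B (fun j => f j + g j) = sumZ B f + sumZ B g.
Proof. by rewrite /sumZ -big_split; apply: eq_bigr => t _ /=; ring. Qed.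

Lemma sumZM B c f : sumZ B (fun j => c * f j) = c * sumZ B f.
Proof. by rewrite /sumZ mulr_sumr; apply: eq_bigr => t _ /=; ring. Qed.

Lemma sumZ_sum B (I : finType) (f : I -> int -> R) :
  \sum_i sumZ B (f i) = sumZ B (fun j => \sum_i f i j).
Proof.
by rewrite exchange_big /=; apply: eq_bigr => t _; rewrite big_split.
Qed.

Lemma sumZ_antisym B f : (forall j, f (1 - j) = - f j) -> sumZ B f = 0.
Proof.
move=> hf; apply: big1 => t _.
have -> : - t%:Z = 1 - (t%:Z + 1) by ring.
by rewrite hf subrr.
Qed.

Lemma sumZ_eq0 B f : (forall j, f j = 0) -> sumZ B f = 0.
Proof. by move=> hf; apply: big1 => t _; rewrite !hf addr0. Qed.

Lemma sumZ_fsum B f : (forall j, f j != 0 -> - B%:Z < j <= B%:Z) ->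
  sumZ B f = \sum_(j \in [set: int]) f j.
Proof.
move=> hf; rewrite (@fsum_range _ f (1 - B%:Z) (B + B)); last first.
  by move=> j /hf; lia.
rewrite big_split_ord /= addrC /sumZ big_split /=; congr (_ + _).
  by apply: eq_bigr => t _; congr f; lia.
rewrite (reindex_inj rev_ord_inj) /=; apply: eq_bigr => t _; congr f.
by have := ltn_ord t; lia.
Qed.

(** Negation does not preserve the interval ]-B, B], so the support has to avoid the endpoint B as
    well as -B. *)
Lemma sumZ_opp B f : (forall j, f j != 0 -> - B%:Z < j < B%:Z) ->
  sumZ B f = sumZ B (fun j => f (- j)).
Proof.
move=> hf; rewrite !sumZ_fsum; first last.
- by move=> j /hf; lia.
- by move=> j /hf; lia.
by apply: reindex_fsbigT; exists (fun j => - j) => j; rewrite opprK.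
Qed.

End SumZ.

Lemma signzN (F : fieldType) (j : int) : (-1) ^ (- j) = (-1) ^ j :> F.
Proof. by rewrite -exprz_inv invrN1. Qed.

Lemma signz1B (F : fieldType) (j : int) : (-1) ^ (1 - j) = - (-1) ^ j :> F.
Proof. by rewrite expfzDr ?oppr_eq0 ?oner_eq0 // signzN expr1z mulN1r. Qed.

(** * Pascal rules and products of q-binomial coefficients *)

Section QBinomial.
Variables (F : fieldType) (q : F).
Hypothesis q1 : forall i : nat, (0 < i)%N -> q ^+ i != 1.

Lemma qpochS n : qpoch q q n.+1 = qpoch q q n * (1 - q ^+ n.+1).
Proof. by rewrite /qpoch big_ord_recr /= exprS. Qed.

Lemma qpoch_neq0 n : qpoch q q n != 0.
Proof.
elim: n => [|n IH]; first by rewrite /qpoch big_ord0 oner_neq0.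
by rewrite qpochS mulf_neq0 // subr_eq0 eq_sym q1.
Qed.

Lemma qbin_out (a b : int) : ~~ (0 <= b <= a) -> qbin q a b = 0.
Proof. by rewrite /qbin => /negPf->. Qed.

Lemma qbin_sym (a b : int) : qbin q a b = qbin q a (a - b).
Proof.
rewrite /qbin; have -> : (0 <= b) && (b <= a) = (0 <= a - b) && (a - b <= a).
  by lia.
case: ifP => // _; congr (_ / _); rewrite mulrC; congr (_ * qpoch _ _ _).
by lia.
Qed.

Lemma qbinE (m n : nat) :
  qbin q (m + n)%N%:Z m%:Z = qpoch q q (m + n) / (qpoch q q m * qpoch q q n).
Proof.
rewrite /qbin; have -> : (0 <= m%:Z) && (m%:Z <= (m + n)%N%:Z) by lia.
by congr (_ / (_ * qpoch _ _ _)); lia.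
Qed.

Lemma qbin0 (n : nat) : qbin q n%:Z 0 = 1.
Proof.
rewrite -[n]add0n qbinE /qpoch big_ord0 mul1r divff //.
exact: qpoch_neq0.
Qed.

Lemma qbinn (n : nat) : qbin q n%:Z n%:Z = 1.
Proof. by rewrite qbin_sym subrr qbin0. Qed.

Lemma qbin_pascal (a : nat) (b : int) :
  qbin q (a%:Z + 1) b =
    qbin q a%:Z b + q ^ (a%:Z + 1 - b) * qbin q a%:Z (b - 1).
Proof.
have E1 : a%:Z + 1 = (a.+1)%:Z by lia.
have [b0|b0] := ltP b 0.
  by rewrite !qbin_out ?mulr0 ?addr0 //; lia.
have [->|bn0] := eqVneq b 0.
  by rewrite E1 !qbin0 qbin_out ?mulr0 ?addr0 //; lia.
have [hb|hb] := ltP (a%:Z + 1) b.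
  by rewrite !qbin_out ?mulr0 ?addr0 //; lia.
have [->|bna] := eqVneq b (a%:Z + 1).
  by rewrite subrr expr0z mul1r addrK E1 !qbinn qbin_out ?add0r //; lia.
have [m Em] : exists m, b = m.+1%:Z by exists `|b|%N.-1; lia.
have [n En] : exists n, a = (m.+1 + n)%N by exists `|(a%:Z - b)%R|%N; lia.
have -> : a%:Z + 1 = (m.+1 + n.+1)%N%:Z by lia.
have -> : (m.+1 + n.+1)%N%:Z - b = n.+1%:Z by lia.
rewrite Em; have -> : m.+1%:Z - 1 = m%:Z by lia.
rewrite qbinE En qbinE; have -> : (m.+1 + n = m + n.+1)%N by lia.
rewrite qbinE addSn !qpochS -exprnP.
have E : q ^+ (m + n.+1).+1 = q ^+ m.+1 * q ^+ n.+1.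
  by rewrite -exprD; congr (_ ^+ _); lia.
rewrite E.
have P1 := qpoch_neq0 m; have P2 := qpoch_neq0 n.
have Q1 : 1 - q ^+ m.+1 != 0 by rewrite subr_eq0 eq_sym q1.
have Q2 : 1 - q ^+ n.+1 != 0 by rewrite subr_eq0 eq_sym q1.
move: (q ^+ m.+1) (q ^+ n.+1) Q1 Q2 => x y Q1 Q2.
by field; rewrite P1 P2 Q1 Q2.
Qed.

Lemma qbin_pascal2 (a : nat) (b : int) :
  qbin q (a%:Z + 1) b = q ^ b * qbin q a%:Z b + qbin q a%:Z (b - 1).
Proof.
rewrite qbin_sym qbin_pascal addrC [in RHS]qbin_sym.
rewrite [X in _ = _ + X]qbin_sym.
by congr (q ^ _ * qbin _ _ _ + qbin _ _ _); lia.
Qed.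

(** Both sides equal (q)_a / ((q)_c (q)_(b-c) (q)_(a-b)) when 0 <= c <= b <= a. Otherwise each side
    has a vanishing factor, so the rule holds for all integers. *)
Lemma qbin_mul_qbin (a b c : int) :
  qbin q a b * qbin q b c = qbin q a c * qbin q (a - c) (b - c).
Proof.
have [h|h] := boolP ((0 <= c <= b) && (b <= a)); last first.
  have : ~~ (0 <= b <= a) || ~~ (0 <= c <= b) by lia.
  move=> /orP[]h1; rewrite (qbin_out h1) ?mul0r ?mulr0.
    have : ~~ (0 <= c <= a) || ~~ (0 <= b - c <= a - c) by lia.
    by move=> /orP[]h2; rewrite (qbin_out h2) ?mul0r ?mulr0.
  have : ~~ (0 <= c <= a) || ~~ (0 <= b - c <= a - c) by lia.
  by move=> /orP[]h2; rewrite (qbin_out h2) ?mul0r ?mulr0.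
have [x Ex] : exists x, c = x%:Z by exists `|c|%N; lia.
have [y Ey] : exists y, b = (x + y)%N%:Z by exists `|(b - c)%R|%N; lia.
have [z Ez] : exists z, a = (x + y + z)%N%:Z by exists `|(a - b)%R|%N; lia.
rewrite Ez Ey Ex qbinE qbinE -addnA qbinE.
have -> : (x + (y + z))%N%:Z - x%:Z = (y + z)%N%:Z by lia.
have -> : (x + y)%N%:Z - x%:Z = y%:Z by lia.
rewrite qbinE.
by field; rewrite !qpoch_neq0.
Qed.

End QBinomial.

(** * Summation formulas: Vandermonde, Nanjundiah, Burge, and the base case *)

Section Sums.
Variables (F : fieldType) (q : F).
Hypothesis q1 : forall i : nat, (0 < i)%N -> q ^+ i != 1.
Hypothesis q0 : q != 0.

(** Induction on A, moving one unit from A to B. Pascal's rule on [A+1, k] splits the summand into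
    [f k + g k]; after shifting the index in [g], the terms [f k] and [g (k + 1)] recombine by
    Pascal's rule on [B+1, n-k]. *)
Lemma qbin_vandermonde (A B : nat) (n : int) :
  \sum_(k < A.+1) q ^ (k%:Z * (B%:Z - n + k%:Z)) * qbin q A%:Z k%:Z
                  * qbin q B%:Z (n - k%:Z)
  = qbin q (A + B)%N%:Z n.
Proof.
elim: A B n => [|A IH] B n.
  by rewrite big_ord1 mul0r expr0z mul1r (qbinn q1) mul1r subr0 add0n.
rewrite addSnnS -IH.
pose f (k : int) := q ^ (k * (B%:Z - n + k + 1)) * qbin q A%:Z k
                  * qbin q B%:Z (n - k).
pose g (k : int) := q ^ (k * (B%:Z - n + k)) * qbin q A%:Z (k - 1)
                  * qbin q B%:Z (n - k).
rewrite (eq_bigr (fun k : 'I_A.+2 => f k%:Z + g k%:Z)); last first.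
  move=> k _; have -> : A.+1%:Z = A%:Z + 1 by lia.
  rewrite (qbin_pascal2 q1) mulrDr mulrDl /f /g; congr (_ + _).
  rewrite mulrA -expfzDr //; congr (q ^ _ * _ * _); ring.
rewrite big_split /= big_ord_recr /= [X in _ + X]big_ord_recl /=.
have -> : f A.+1 = 0 by rewrite /f qbin_out ?mulr0 ?mul0r //; lia.
have -> : g 0 = 0 by rewrite /g [qbin q A%:Z _]qbin_out ?mulr0 ?mul0r //; lia.
rewrite addr0 add0r -big_split /=; apply: eq_bigr => k _.
have -> : B.+1%:Z = B%:Z + 1 by lia.
rewrite (qbin_pascal q1) mulrDr /f /g; congr (_ + _).
  by congr (q ^ _ * _ * _); ring.
have -> : (bump 0 k)%:Z = k%:Z + 1 by rewrite /bump; lia.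
rewrite mulrA addrK.
rewrite [X in _ = X * _]mulrAC -expfzDr //; congr (q ^ _ * _ * qbin q _ _); ring.
Qed.

Lemma qbin_vandermonde2 (A B : nat) (n : int) :
  \sum_(k < A.+1) q ^ ((A%:Z - k%:Z) * (n - k%:Z)) * qbin q A%:Z k%:Z
                  * qbin q B%:Z (n - k%:Z)
  = qbin q (A + B)%N%:Z n.
Proof.
rewrite qbin_sym -qbin_vandermonde [RHS](reindex_inj rev_ord_inj) /=.
apply: eq_bigr => k _; rewrite subSS [in RHS]qbin_sym [X in _ = _ * X]qbin_sym.
have -> : (A - k)%N%:Z = A%:Z - k%:Z by have := ltn_ord k; lia.
have -> : (A + B)%N%:Z = A%:Z + B%:Z by lia.
by congr (q ^ _ * qbin q _ _ * qbin q _ _); ring.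
Qed.

(* Expanding [x + t, p + s] by Vandermonde makes the sum over t, and then the
   remaining sum over the Vandermonde index, a Vandermonde sum again. *)
Lemma qbin_nanjundiah (p s x : nat) (n : int) :
  (p + s)%N%:Z - n <= x%:Z ->
  \sum_(t < p.+1) q ^ ((p%:Z - t%:Z) * (n - t%:Z)) * qbin q p%:Z t%:Z
     * qbin q s%:Z (n - t%:Z) * qbin q (x%:Z + t%:Z) (p + s)%N%:Z
  = qbin q x%:Z ((p + s)%N%:Z - n) * qbin q (x%:Z + n - s%:Z) n.
Proof.
move=> hx; pose K := (p + s)%N%:Z.
transitivity (\sum_(t < p.+1) \sum_(k < p.+1)
   q ^ ((p%:Z - t%:Z) * (n - t%:Z)) * qbin q s%:Z (n - t%:Z)
   * (qbin q p%:Z t%:Z * qbin q t%:Z k%:Z)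
   * (q ^ (k%:Z * (x%:Z - K + k%:Z)) * qbin q x%:Z (K - k%:Z))).
  apply: eq_bigr => t _.
  have -> : x%:Z + t%:Z = (t + x)%N%:Z by lia.
  rewrite -qbin_vandermonde.
  pose f (k : int) := q ^ (k * (x%:Z - K + k)) * qbin q t%:Z k
                  * qbin q x%:Z (K - k).
  rewrite (@big_ord_supp _ f _ p.+1); last first.
    move=> k k0; rewrite /f !mulf_eq0 !negb_or -andbA => /and3P[_ /qbin_neq0 + _].
    by have := ltn_ord t; lia.
  rewrite mulr_sumr; apply: eq_bigr => k _; rewrite /f; ring.
rewrite exchange_big /=.
transitivity (\sum_(k < p.+1) q ^ (k%:Z * (x%:Z - K + k%:Z)) * qbin q p%:Z k%:Z
   * (qbin q x%:Z (K - k%:Z) * qbin q (K - k%:Z) (K - n))).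
  apply: eq_bigr => k _.
  pose f (t : int) := q ^ ((p%:Z - t) * (n - t)) * qbin q (p%:Z - k%:Z) (t - k%:Z)
     * qbin q s%:Z (n - t).
  transitivity (q ^ (k%:Z * (x%:Z - K + k%:Z)) * qbin q p%:Z k%:Z
      * qbin q x%:Z (K - k%:Z) * \sum_(t < p.+1) f (0 + t%:Z)).
    rewrite mulr_sumr; apply: eq_bigr => t _; rewrite (qbin_mul_qbin q1) /f add0r.
    by ring.
  have lk := ltn_ord k.
  rewrite -mulrA; congr (_ * (_ * _)).
  have fs (j : int) : f j != 0 -> k%:Z <= j <= p%:Z.
    rewrite /f !mulf_eq0 !negb_or -andbA => /and3P[_ /qbin_neq0 + _]; lia.
  rewrite -fsum_range; last by move=> j /fs; lia.
  rewrite (@fsum_range _ f k%:Z (p - k).+1); last by move=> j /fs; lia.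
  have -> : qbin q (K - k%:Z) (K - n) = qbin q ((p - k) + s)%N%:Z (n - k%:Z).
    by rewrite qbin_sym; congr (qbin q _ _); rewrite /K; lia.
  rewrite -qbin_vandermonde2; apply: eq_bigr => t _; rewrite /f.
  have -> : (p - k)%N%:Z = p%:Z - k%:Z by lia.
  by congr (q ^ _ * qbin q _ _ * qbin q _ _); ring.
(* The hypothesis [hx] makes x - (K - n) a natural number, the second parameter of the remaining
   Vandermonde sum over k. *)
have [y Ey] : exists y : nat, x%:Z - (K - n) = y%:Z.
  by exists `|(x%:Z - (K - n))%R|%N; rewrite /K; lia.
have -> : x%:Z + n - s%:Z = (p + y)%N%:Z by move: Ey; rewrite /K; lia.
rewrite -qbin_vandermonde mulr_sumr; apply: eq_bigr => k _.
rewrite (qbin_mul_qbin q1) Ey.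
have -> : K - k%:Z - (K - n) = n - k%:Z by ring.
have -> : y%:Z - n + k%:Z = x%:Z - K + k%:Z by lia.
by ring.
Qed.

(** Vandermonde with r + al as index. The first hypothesis ensures that r >= 0 cuts off no nonzero
    term, the third that r < N cuts off none. If p or s is negative the left side is empty, and the
    second hypothesis puts the lower index on the right out of range. *)
Lemma qbin_vandermonde_shift (p s al be : int) (N : nat) :
  al <= 0 \/ be <= 0 ->
  (p < 0 \/ s < 0 -> p + be < al \/ s + al < be) ->
  p - al < N%:Z \/ s - be < N%:Z ->
  \sum_(r < N) q ^ ((r%:Z + al) * (r%:Z + be))
     * qbin q p (r%:Z + al) * qbin q s (r%:Z + be)
  = qbin q (p + s) (s + al - be).
Proof.
move=> h1 h2 h3.
pose f (r : int) := q ^ ((r + al) * (r + be)) * qbin q p (r + al)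
  * qbin q s (r + be).
have fs (r : int) : f r != 0 -> 0 <= r + al <= p /\ 0 <= r + be <= s.
  rewrite /f !mulf_eq0 !negb_or -andbA => /and3P[_ /qbin_neq0 + /qbin_neq0].
  by [].
have [hp|hp] := boolP ((0 <= p) && (0 <= s)); last first.
  rewrite big1 => [|r _]; last first.
    by apply/eqP/negPn/negP => /fs[]; lia.
  by rewrite qbin_out //; lia.
have [P EP] : exists P : nat, p = P%:Z by exists `|p|%N; lia.
have [S ES] : exists S : nat, s = S%:Z by exists `|s|%N; lia.
transitivity (\sum_(r < N) f (0 + r%:Z)).
  by apply: eq_bigr => r _; rewrite add0r.
rewrite -fsum_range; last by move=> r /fs; lia.
rewrite (@fsum_range _ f (- al) P.+1); last by move=> r /fs; lia.
have -> : p + s = (P + S)%N%:Z by lia.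
rewrite -qbin_vandermonde; apply: eq_bigr => k _.
rewrite /f [qbin q s _]qbin_sym -EP -ES.
by congr (q ^ _ * qbin q _ _ * qbin q _ _); ring.
Qed.

(** This is [qbin_nanjundiah] read backwards, with t = p - al - r, n = p + be - al and x = s + M +
    al. The hypotheses on the shifts and on negative p, s serve as in [qbin_vandermonde_shift]; here
    r <= M is enforced by the first q-binomial. *)
Lemma qbin_burge (p s al be : int) (M : nat) :
  al <= 0 \/ be <= 0 ->
  (p < 0 \/ s < 0 -> p + be < al \/ s + al < be) ->
  \sum_(r < M.+1) q ^ ((r%:Z + al) * (r%:Z + be))
     * qbin q (p + s + M%:Z - r%:Z) (M%:Z - r%:Z)
     * qbin q p (r%:Z + al) * qbin q s (r%:Z + be)
  = qbin q (s + M%:Z + al) (M%:Z + be) * qbin q (p + M%:Z + be) (M%:Z + al).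
Proof.
move=> h1 h2.
pose f (r : int) := q ^ ((r + al) * (r + be))
     * qbin q (p + s + M%:Z - r) (M%:Z - r)
     * qbin q p (r + al) * qbin q s (r + be).
have fs (r : int) : f r != 0 ->
    [/\ 0 <= r + al <= p, 0 <= r + be <= s & r <= M%:Z].
  rewrite /f !mulf_eq0 !negb_or -!andbA.
  move=> /and4P[_ /qbin_neq0 + /qbin_neq0 + /qbin_neq0].
  by move=> h ? ?; split=> //; lia.
(* Outside this range every summand vanishes, and so does one of the two q-binomials on the right.
   Inside it, x is a natural number and the condition of [qbin_nanjundiah] reads 0 <= M + be. *)
have [hp|hp] := boolP [&& 0 <= p, 0 <= s, 0 <= M%:Z + al & 0 <= M%:Z + be];
  last first.
  rewrite big1 => [|r _]; last first.
    by apply/eqP/negPn/negP => /fs[]; lia.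
  have : ~~ (0 <= M%:Z + be <= s + M%:Z + al) || ~~ (0 <= M%:Z + al <= p + M%:Z + be).
    by lia.
  by case/orP => /qbin_out->; rewrite ?mulr0 ?mul0r.
have [P EP] : exists P : nat, p = P%:Z by exists `|p|%N; lia.
have [S ES] : exists S : nat, s = S%:Z by exists `|s|%N; lia.
have [x Ex] : exists x : nat, s + M%:Z + al = x%:Z by exists `|(s + M%:Z + al)%R|%N; lia.
transitivity (\sum_(r < M.+1) f (0 + r%:Z)).
  by apply: eq_bigr => r _; rewrite add0r.
rewrite -fsum_range; last by move=> r /fs[]; lia.
rewrite (reindex_fsbigT (fun t => p - al - t)); last first.
  by exists (fun t => p - al - t) => t; ring.
rewrite (@fsum_range _ _ 0 P.+1); last by move=> r /fs[]; lia.
have := @qbin_nanjundiah P S x (p + be - al).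
have -> : x%:Z + (p + be - al) - S%:Z = p + M%:Z + be by lia.
rewrite [qbin q x%:Z _]qbin_sym [qbin q (p + _ + _) _]qbin_sym.
have -> : x%:Z - ((P + S)%N%:Z - (p + be - al)) = M%:Z + be by lia.
have -> : p + M%:Z + be - (p + be - al) = M%:Z + al by ring.
rewrite Ex => <-; last by lia.
apply: eq_bigr => t _; rewrite /f add0r [X in _ * X * _ * _]qbin_sym.
rewrite [qbin q p _]qbin_sym -EP -ES.
have -> : p + s + M%:Z - (p - al - t%:Z) = x%:Z + t%:Z by lia.
have -> : x%:Z + t%:Z - (M%:Z - (p - al - t%:Z)) = (P + S)%N%:Z by lia.
have -> : p - (p - al - t%:Z + al) = t%:Z by ring.
have -> : p - al - t%:Z + be = p + be - al - t%:Z by ring.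
have -> : p - al - t%:Z + al = p - t%:Z by ring.
by ring.
Qed.

(** Classically, the coefficient form of (z;q)_n (-z;q)_n = (z^2;q^2)_n. The induction on n applies
    Pascal's rule to the two factors in turn: the cross terms are multiples of [h], which is
    antisymmetric under j |-> 1 - j, and what is left is Pascal's rule in base q^2. *)
Lemma qbin_sqr (B n : nat) (l : int) : (n < B)%N ->
  sumZ B (fun j => (-1) ^ j * q ^ (j ^+ 2) * qbin q n%:Z (l - j)
                   * qbin q n%:Z (l + j))
  = qbin (q ^+ 2) n%:Z l.
Proof.
have q1' i : (0 < i)%N -> (q ^+ 2) ^+ i != 1.
  by move=> i0; rewrite -exprM q1 // muln_gt0.
elim: n l => [|n IH] l lB.
  have [->|l0] := eqVneq l 0.
    rewrite sumZ_fsum => [|j]; last first.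
      rewrite !mulf_eq0 !negb_or -!andbA => /and4P[_ _ /qbin_neq0 + /qbin_neq0].
      by lia.
    rewrite (@fsum_range _ _ 0 1) => [|j]; last first.
      rewrite !mulf_eq0 !negb_or -!andbA => /and4P[_ _ /qbin_neq0 + /qbin_neq0].
      by lia.
    rewrite big_ord1 (_ : 0 + _ = 0 :> int) // expr0n /= !expr0z ?subr0 ?addr0.
    rewrite (qbin0 q1) (qbin0 q1').
    by rewrite !mulr1.
  rewrite [RHS]qbin_out; last by lia.
  apply: sumZ_eq0 => j; apply/eqP/negPn/negP.
  rewrite !mulf_eq0 !negb_or -!andbA => /and4P[_ _ /qbin_neq0 + /qbin_neq0].
  by lia.
have -> : n.+1%:Z = n%:Z + 1 by lia.
pose c := q ^ (n%:Z + 1 - l).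
pose h j := (-1) ^ j * q ^ (j ^+ 2 - j) * qbin q n%:Z (l - j)
  * qbin q n%:Z (l + j - 1).
pose u j := (-1) ^ j * q ^ (j ^+ 2) * qbin q (n%:Z + 1) (l - j)
  * qbin q n%:Z (l + j).
have h0 : sumZ B h = 0.
  apply: sumZ_antisym => j; rewrite /h signz1B.
  have -> : (1 - j) ^+ 2 - (1 - j) = j ^+ 2 - j by ring.
  have -> : l - (1 - j) = l + j - 1 by ring.
  have -> : l + (1 - j) - 1 = l - j by ring.
  by ring.
transitivity (sumZ B u + c * sumZ B h + c ^+ 2 * qbin (q ^+ 2) n%:Z (l - 1)).
  rewrite -IH; last by lia.
  rewrite -!sumZM -!sumZD; apply: eq_sumZ => j.
  rewrite [X in _ * X = _](qbin_pascal q1) // mulrDr -[RHS]addrA; congr (_ + _).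
  rewrite (qbin_pascal q1) // /h /c.
  have -> : n%:Z + 1 - (l + j) = (n%:Z + 1 - l) - j by ring.
  have -> : n%:Z + 1 - (l - j) = (n%:Z + 1 - l) + j by ring.
  have -> : l - 1 - j = l - j - 1 by ring.
  have -> : l - 1 + j = l + j - 1 by ring.
  rewrite !expfzDr //.
  have : q ^ j * q ^ (- j) = 1 by rewrite -expfzDr // subrr expr0z.
  move: (q ^ j) (q ^ (- j)) => x y xy; rewrite !mulrDr !mulrDl; congr (_ + _).
    by ring.
  transitivity ((-1) ^ j * q ^ (j ^+ 2) * (q ^ n%:Z * q ^ 1 * q ^ (- l)) ^+ 2
     * (x * y) * qbin q n%:Z (l - j - 1) * qbin q n%:Z (l + j - 1)).
    by ring.
  by rewrite xy; ring.
rewrite h0 mulr0 addr0 (qbin_pascal q1') //; congr (_ + _ * _); last first.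
  by rewrite /c exprnP exprnP !exprz_exp mulrC.
(* Reflecting j |-> -j turns the leftover cross term of [u] into the same [h], so that it vanishes
   too. *)
rewrite sumZ_opp => [|j]; last first.
  rewrite /u !mulf_eq0 !negb_or -!andbA => /and4P[_ _ /qbin_neq0 + /qbin_neq0].
  by lia.
transitivity (qbin (q ^+ 2) n%:Z l + c * sumZ B h); last first.
  by rewrite h0 mulr0 addr0.
rewrite -IH; last by lia.
rewrite -!sumZM -!sumZD; apply: eq_sumZ => j.
rewrite /u signzN sqrrN opprK (qbin_pascal q1) // /h /c.
have -> : n%:Z + 1 - (l + j) = (n%:Z + 1 - l) - j by ring.
rewrite !expfzDr //; ring.
Qed.
End Sums.

(** * The iterated Burge transform, then the sum over m and k *)

Section Levels.
Variables (F : fieldType) (q : F).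
Hypothesis q1 : forall i : nat, (0 < i)%N -> q ^+ i != 1.
Hypothesis q0 : q != 0.
Variable Delta : nat.

(* With M = N_(v-1-i) and L = k - (N_1 + ... + N_(v-1-i)), this is the sum over
   N_(v-i), ..., N_(v-1), without the power of q coming from M itself. *)
Fixpoint fermi (i : nat) (L : int) (M : nat) : F :=
  if i is i'.+1 then
    \sum_(r < M.+1) q ^+ (r ^ 2 + (i <= Delta) * r)%N
      * qbin q (M%:Z - r%:Z + 2 * L + (minn Delta i)%:Z) (M%:Z - r%:Z)
      * fermi i' (L - r%:Z) r
  else qbin (q ^+ 2) (L + M%:Z) M%:Z.

(** Summands of the closed form of [fermi]: [bose_low] serves the levels i <= Delta, where the
    exponent has a linear part in r, and [bose_high] with D = Delta the levels i >= Delta. At i =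
    Delta the two sums agree. *)
Definition bose_low (i : nat) (L : int) (M : nat) (j : int) : F :=
  (-1) ^ j * q ^ ((i%:Z + 1) * j ^+ 2 - i%:Z * j)
  * qbin q (L + M%:Z + i%:Z * (1 - j)) (L + i%:Z - (i%:Z + 1) * j)
  * qbin q (L + M%:Z + 1 + i%:Z * j) (L + (i%:Z + 1) * j).

Definition bose_high (D i : nat) (L : int) (M : nat) (j : int) : F :=
  (-1) ^ j * q ^ ((i%:Z + 1) * j ^+ 2 - D%:Z * j)
  * qbin q (L + M%:Z + D%:Z - i%:Z * j) (L + D%:Z - (i%:Z + 1) * j)
  * qbin q (L + M%:Z + i%:Z * j) (L + (i%:Z + 1) * j).

(* Pascal's rule on the last factor of bose_low; the extra term it produces is
   antisymmetric under j |-> 1 - j. *)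
Lemma bose_lowE B i L M :
  sumZ B (bose_low i L M) = sumZ B (bose_high i i L M).
Proof.
have [L0|L0] := ltP L 0.
  (* For L < 0, nonnegative lower indices would force 0 < (i + 1) j < i, which no multiple of i + 1
     satisfies; so both sums are zero term by term. *)
  have hj (j : int) : (i%:Z + 1) * j <= 0 \/ i%:Z + 1 <= (i%:Z + 1) * j.
    by have [|] := lerP j 0; nia.
  rewrite !sumZ_eq0 // => j; apply/eqP/negPn/negP.
    rewrite /bose_high !mulf_eq0 !negb_or -!andbA.
    by move=> /and4P[_ _ /qbin_neq0 + /qbin_neq0]; have := hj j; lia.
  rewrite /bose_low !mulf_eq0 !negb_or -!andbA.
  by move=> /and4P[_ _ /qbin_neq0 + /qbin_neq0]; have := hj j; lia.
pose h (j : int) := (-1) ^ j * q ^ ((i%:Z + 1) * (j ^+ 2 - j))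
  * qbin q (L + M%:Z + i%:Z * (1 - j)) (L + i%:Z - (i%:Z + 1) * j)
  * qbin q (L + M%:Z + i%:Z * j) (L + (i%:Z + 1) * j - 1).
have h0 : sumZ B h = 0.
  apply: sumZ_antisym => j; rewrite /h signz1B.
  have -> : (1 - j) ^+ 2 - (1 - j) = j ^+ 2 - j by ring.
  have -> : 1 - (1 - j) = j by ring.
  have -> : L + i%:Z - (i%:Z + 1) * (1 - j) = L + (i%:Z + 1) * j - 1 by ring.
  have -> : L + (i%:Z + 1) * (1 - j) - 1 = L + i%:Z - (i%:Z + 1) * j by ring.
  by ring.
transitivity (sumZ B (bose_high i i L M) + q ^ (M%:Z + 1) * sumZ B h); last first.
  by rewrite h0 mulr0 addr0.
rewrite -sumZM -sumZD; apply: eq_sumZ => j; rewrite /bose_low /bose_high /h.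
have -> : L + M%:Z + i%:Z - i%:Z * j = L + M%:Z + i%:Z * (1 - j) by ring.
(* Pascal's rule needs a natural upper index. If this one is negative, L >= 0 forces j < 0; the
   lower indices are then negative and all three terms vanish. *)
have [t0|t0] := ltP (L + M%:Z + i%:Z * j) 0.
  rewrite [X in _ * X = _]qbin_out; last by nia.
  by rewrite [X in _ = _ * X + _]qbin_out ?[X in _ = _ + _ * (_ * X)]qbin_out
    ?mulr0 ?addr0 //; nia.
have [t Et] : exists t : nat, L + M%:Z + i%:Z * j = t%:Z.
  by exists `|(L + M%:Z + i%:Z * j)%R|%N; lia.
have -> : L + M%:Z + 1 + i%:Z * j = t%:Z + 1 by rewrite -Et; ring.
rewrite (qbin_pascal q1) mulrDr Et; congr (_ + _).
have -> : t%:Z + 1 - (L + (i%:Z + 1) * j) = M%:Z + 1 - j.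
  by rewrite -Et; ring.
have -> : (i%:Z + 1) * j ^+ 2 - i%:Z * j = (i%:Z + 1) * (j ^+ 2 - j) + j by ring.
rewrite !(expfzDr _ _ q0).
have : q ^ j * q ^ (- j) = 1 by rewrite -expfzDr // subrr expr0z.
move: (q ^ j) (q ^ (- j)) => x y xy.
set A := q ^ (_ * _); set C := qbin _ _ _; set D := qbin _ _ _.
transitivity ((-1) ^ j * A * C * (q ^ M%:Z * q ^ 1 * (x * y) * D)); first by ring.
by rewrite xy; ring.
Qed.

(** Each step is [qbin_burge] at fixed j with shifts 1 - j and j, of which one is always <= 0. The
    exponent fits because (r + 1 - j)(r + j) = r^2 + r - (j^2 - j), and j^2 - j is the growth of the
    prefactor from level i to i + 1. *)
Lemma fermi_bose_low B i L M : (i <= Delta)%N -> L + M%:Z < B%:Z ->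
  fermi i L M = sumZ B (bose_low i L M).
Proof.
elim: i L M => [|i IH] L M iD LB.
  rewrite bose_lowE /= qbin_sym addrK.
  have [L0|L0] := ltP (L + M%:Z) 0.
    rewrite qbin_out; last by lia.
    rewrite sumZ_eq0 // => j; rewrite /bose_high [X in _ * X]qbin_out ?mulr0 //.
    by lia.
  have [n En] : exists n : nat, L + M%:Z = n%:Z.
    by exists `|(L + M%:Z)%R|%N; lia.
  rewrite En -(@qbin_sqr _ _ q1 q0 B); last by lia.
  apply: eq_sumZ => j; rewrite /bose_high En.
  by congr ((-1) ^ j * q ^ _ * qbin q _ _ * qbin q _ _); ring.
transitivity (\sum_(r < M.+1) sumZ B (fun j => q ^+ (r ^ 2 + r)
      * qbin q (M%:Z - r%:Z + 2 * L + (minn Delta i.+1)%:Z) (M%:Z - r%:Z)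
      * bose_low i (L - r%:Z) r j)).
  by apply: eq_bigr => r _; rewrite iD mul1n sumZM -IH //; lia.
rewrite sumZ_sum; apply: eq_sumZ => j; rewrite /bose_low.
pose c := (-1) ^ j * q ^ ((i.+1%:Z + 1) * j ^+ 2 - i.+1%:Z * j) : F.
pose p := L + 1 + i%:Z * j; pose s := L + i%:Z * (1 - j).
transitivity (c * \sum_(r < M.+1) q ^ ((r%:Z + (1 - j)) * (r%:Z + j))
   * qbin q (p + s + M%:Z - r%:Z) (M%:Z - r%:Z)
   * qbin q p (r%:Z + (1 - j)) * qbin q s (r%:Z + j)).
  rewrite mulr_sumr; apply: eq_bigr => r _; rewrite /c /p /s.
  have -> : (minn Delta i.+1)%:Z = i%:Z + 1 by lia.
  have -> : M%:Z - r%:Z + 2 * L + (i%:Z + 1)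
    = L + 1 + i%:Z * j + (L + i%:Z * (1 - j)) + M%:Z - r%:Z by ring.
  rewrite !subrK [qbin q (L + 1 + i%:Z * j) _]qbin_sym.
  rewrite [qbin q (L + i%:Z * (1 - j)) (r%:Z + j)]qbin_sym.
  have -> : L + 1 + i%:Z * j - (L - r%:Z + (i%:Z + 1) * j) = r%:Z + (1 - j) by ring.
  have -> : L + i%:Z * (1 - j) - (r%:Z + j) = L - r%:Z + i%:Z - (i%:Z + 1) * j.
    by ring.
  have -> : (r%:Z + (1 - j)) * (r%:Z + j) = (r ^ 2 + r)%N%:Z + (j - j ^+ 2).
    by (have -> : (r ^ 2 + r)%N%:Z = r%:Z * r%:Z + r%:Z by lia); ring.
  have -> : (i.+1%:Z + 1) * j ^+ 2 - i.+1%:Z * j =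
    ((i%:Z + 1) * j ^+ 2 - i%:Z * j) + (j ^+ 2 - j).
    by (have -> : i.+1%:Z = i%:Z + 1 by lia); ring.
  rewrite [q ^ (_ + (j ^+ 2 - j))]expfzDr // [q ^ (_ + (j - j ^+ 2))]expfzDr //.
  have : q ^ (j ^+ 2 - j) * q ^ (j - j ^+ 2) = 1.
    by rewrite -expfzDr // (_ : _ + _ = 0) ?expr0z //; ring.
  move: (q ^ (j ^+ 2 - j)) (q ^ (j - j ^+ 2)) => x y xy.
  rewrite -exprnP.
  set X1 := qbin _ _ _; set X2 := qbin _ _ _; set X3 := qbin _ _ _.
  set X4 := q ^ _; set X5 := q ^+ _.
  transitivity ((x * y) * X1 * X2 * X3 * X4 * X5 * (-1) ^ j); last by ring.
  by rewrite xy; ring.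
rewrite (qbin_burge q1 q0); first last.
- by rewrite /p /s; nia.
- by lia.
rewrite /c /p /s mulrA.
rewrite [X in _ * X * _]qbin_sym [X in _ * X = _]qbin_sym.
congr (_ * qbin q _ _ * qbin q _ _).
all: by (have -> : i.+1%:Z = i%:Z + 1 by lia); ring.
Qed.

(** The induction starts at i = Delta, where [bose_lowE] changes the shape of the summand. From
    there on the linear part of the exponent is gone and the minimum stays at Delta, so the shifts
    become -j and j, with (r - j)(r + j) = r^2 - j^2. *)
Lemma fermi_bose_high B i L M : (Delta <= i)%N -> L + M%:Z < B%:Z ->
  fermi i L M = sumZ B (bose_high Delta i L M).
Proof.
move=> /subnKC <-; elim: (i - Delta)%N L M => {i} [|i IH] L M LB.
  by rewrite addn0 -bose_lowE -fermi_bose_low.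
rewrite addnS; set k := (Delta + i)%N in IH *.
have Dk : (Delta <= k)%N by rewrite leq_addr.
have -> : fermi k.+1 L M = \sum_(r < M.+1) sumZ B (fun j => q ^+ (r ^ 2)
      * qbin q (M%:Z - r%:Z + 2 * L + Delta%:Z) (M%:Z - r%:Z)
      * bose_high Delta k (L - r%:Z) r j).
  apply: eq_bigr => r _.
  have -> : (k < Delta)%N = false by lia.
  rewrite mul0n addn0 sumZM -IH; last by lia.
  by congr (_ * qbin q _ _ * _); lia.
rewrite sumZ_sum; apply: eq_sumZ => j; rewrite /bose_high.
pose c := (-1) ^ j * q ^ ((k.+1%:Z + 1) * j ^+ 2 - Delta%:Z * j) : F.
pose p := L + k%:Z * j; pose s := L + Delta%:Z - k%:Z * j.
transitivity (c * \sum_(r < M.+1) q ^ ((r%:Z + (- j)) * (r%:Z + j))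
   * qbin q (p + s + M%:Z - r%:Z) (M%:Z - r%:Z)
   * qbin q p (r%:Z + (- j)) * qbin q s (r%:Z + j)).
  rewrite mulr_sumr; apply: eq_bigr => r _; rewrite /c /p /s.
  have -> : M%:Z - r%:Z + 2 * L + Delta%:Z
    = L + k%:Z * j + (L + Delta%:Z - k%:Z * j) + M%:Z - r%:Z by ring.
  rewrite !subrK [qbin q (L + k%:Z * j) (_ - j)]qbin_sym.
  rewrite [qbin q (L + Delta%:Z - k%:Z * j) (r%:Z + j)]qbin_sym.
  have -> : L + k%:Z * j - (r%:Z - j) = L - r%:Z + (k%:Z + 1) * j by ring.
  have -> : L + Delta%:Z - k%:Z * j - (r%:Z + j)
    = L - r%:Z + Delta%:Z - (k%:Z + 1) * j by ring.
  have -> : (r%:Z - j) * (r%:Z + j) = (r ^ 2)%N%:Z - j ^+ 2.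
    by (have -> : (r ^ 2)%N%:Z = r%:Z * r%:Z by lia); ring.
  have -> : (k.+1%:Z + 1) * j ^+ 2 - Delta%:Z * j =
    ((k%:Z + 1) * j ^+ 2 - Delta%:Z * j) + j ^+ 2.
    by (have -> : k.+1%:Z = k%:Z + 1 by lia); ring.
  rewrite [q ^ (_ + j ^+ 2)]expfzDr // [q ^ (_ - j ^+ 2)]expfzDr //.
  have : q ^ (j ^+ 2) * q ^ (- j ^+ 2) = 1.
    by rewrite -expfzDr // subrr expr0z.
  move: (q ^ (j ^+ 2)) (q ^ (- j ^+ 2)) => x y xy.
  rewrite -exprnP.
  set X1 := qbin _ _ _; set X2 := qbin _ _ _; set X3 := qbin _ _ _.
  set X4 := q ^ _; set X5 := q ^+ _.
  transitivity ((x * y) * X1 * X2 * X3 * X4 * X5 * (-1) ^ j); last by ring.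
  by rewrite xy; ring.
rewrite (qbin_burge q1 q0); first last.
- by rewrite /p /s; nia.
- by lia.
rewrite /c /p /s mulrA.
rewrite [X in _ * X * _]qbin_sym [X in _ * X = _]qbin_sym.
congr (_ * qbin q _ _ * qbin q _ _).
all: by (have -> : k.+1%:Z = k%:Z + 1 by lia); ring.
Qed.

(** The outermost sum, over M = N_1 with i = v - 2. Since L + M = k is fixed, the upper indices do
    not depend on M and a shifted Vandermonde sum suffices. The extreme case Delta = v - 1, where
    N_1 also enters linearly, starts from [bose_low]. *)
Lemma fermi_sum B i (k : nat) : (k < B)%N -> (Delta <= i.+1)%N ->
  \sum_(M < k.+1) q ^+ (M ^ 2 + (i.+1 <= Delta) * M)%N * fermi i (k%:Z - M%:Z) M
  = sumZ B (fun j => (-1) ^ j * q ^ ((i%:Z + 2) * j ^+ 2 - Delta%:Z * j)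
       * qbin q (2 * k%:Z + Delta%:Z) (k%:Z + (i%:Z + 2) * j)).
Proof.
move=> kB Di; case: (ltnP i Delta) => iD; last first.
  transitivity (\sum_(M < k.+1) sumZ B (fun j => q ^+ (M ^ 2) *
    bose_high Delta i (k%:Z - M%:Z) M j)).
    apply: eq_bigr => M _; rewrite sumZM -fermi_bose_high //; last by lia.
    by rewrite mul0n addn0.
  rewrite sumZ_sum; apply: eq_sumZ => j; rewrite /bose_high.
  pose p := k%:Z + i%:Z * j; pose s := k%:Z + Delta%:Z - i%:Z * j.
  pose c := (-1) ^ j * q ^ ((i%:Z + 2) * j ^+ 2 - Delta%:Z * j) : F.
  transitivity (c * \sum_(r < k.+1) q ^ ((r%:Z + (- j)) * (r%:Z + j))
    * qbin q p (r%:Z + (- j)) * qbin q s (r%:Z + j)).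
    rewrite mulr_sumr; apply: eq_bigr => r _; rewrite /c /p /s.
    rewrite !subrK [qbin q (k%:Z + i%:Z * j) (_ - j)]qbin_sym.
    rewrite [qbin q (k%:Z + Delta%:Z - i%:Z * j) (r%:Z + j)]qbin_sym.
    have -> : k%:Z + i%:Z * j - (r%:Z - j) = k%:Z - r%:Z + (i%:Z + 1) * j by ring.
    have -> : k%:Z + Delta%:Z - i%:Z * j - (r%:Z + j)
      = k%:Z - r%:Z + Delta%:Z - (i%:Z + 1) * j by ring.
    have -> : (r%:Z - j) * (r%:Z + j) = (r ^ 2)%N%:Z - j ^+ 2.
      by (have -> : (r ^ 2)%N%:Z = r%:Z * r%:Z by lia); ring.
    have -> : (i%:Z + 2) * j ^+ 2 - Delta%:Z * j =
      ((i%:Z + 1) * j ^+ 2 - Delta%:Z * j) + j ^+ 2 by ring.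
    rewrite [q ^ (_ + j ^+ 2)]expfzDr // [q ^ (_ - j ^+ 2)]expfzDr //.
    have : q ^ (j ^+ 2) * q ^ (- j ^+ 2) = 1.
      by rewrite -expfzDr // subrr expr0z.
    move: (q ^ (j ^+ 2)) (q ^ (- j ^+ 2)) => x y xy.
    rewrite -exprnP.
    set X2 := qbin _ _ _; set X3 := qbin _ _ _.
    set X4 := q ^ _; set X5 := q ^+ _.
    transitivity ((x * y) * X2 * X3 * X4 * X5 * (-1) ^ j); last by ring.
    by rewrite xy; ring.
  rewrite (qbin_vandermonde_shift q1 q0); first last.
  - by rewrite /p /s; have [j0|j0] := lerP j 0; [left|right]; nia.
  - by rewrite /p /s; nia.
  - by lia.
  by rewrite qbin_sym /c /p /s; congr (_ * qbin q _ _); ring.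
have {}Di : Delta = i.+1 by lia.
transitivity (\sum_(M < k.+1) sumZ B (fun j => q ^+ (M ^ 2 + M) *
    bose_low i (k%:Z - M%:Z) M j)).
  apply: eq_bigr => M _; rewrite sumZM -fermi_bose_low //; [|lia..].
  by rewrite mul1n.
rewrite sumZ_sum; apply: eq_sumZ => j; rewrite /bose_low.
pose p := k%:Z + 1 + i%:Z * j; pose s := k%:Z + i%:Z * (1 - j).
pose c := (-1) ^ j * q ^ ((i%:Z + 2) * j ^+ 2 - Delta%:Z * j) : F.
transitivity (c * \sum_(r < k.+1) q ^ ((r%:Z + (1 - j)) * (r%:Z + j))
  * qbin q p (r%:Z + (1 - j)) * qbin q s (r%:Z + j)).
  rewrite mulr_sumr; apply: eq_bigr => r _; rewrite /c /p /s.
  rewrite !subrK [qbin q (k%:Z + 1 + i%:Z * j) _]qbin_sym.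
  rewrite [qbin q (k%:Z + i%:Z * (1 - j)) (r%:Z + j)]qbin_sym.
  have -> : k%:Z + 1 + i%:Z * j - (k%:Z - r%:Z + (i%:Z + 1) * j) = r%:Z + (1 - j).
    by ring.
  have -> : k%:Z + i%:Z * (1 - j) - (r%:Z + j) = k%:Z - r%:Z + i%:Z - (i%:Z + 1) * j.
    by ring.
  have -> : (r%:Z + (1 - j)) * (r%:Z + j) = (r ^ 2 + r)%N%:Z + (j - j ^+ 2).
    by (have -> : (r ^ 2 + r)%N%:Z = r%:Z * r%:Z + r%:Z by lia); ring.
  have -> : (i%:Z + 2) * j ^+ 2 - Delta%:Z * j =
    ((i%:Z + 1) * j ^+ 2 - i%:Z * j) + (j ^+ 2 - j).
    by (have -> : Delta%:Z = i%:Z + 1 by lia); ring.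
  rewrite [q ^ (_ + (j ^+ 2 - j))]expfzDr // [q ^ (_ + (j - j ^+ 2))]expfzDr //.
  have : q ^ (j ^+ 2 - j) * q ^ (j - j ^+ 2) = 1.
    by rewrite -expfzDr // (_ : _ + _ = 0) ?expr0z //; ring.
  move: (q ^ (j ^+ 2 - j)) (q ^ (j - j ^+ 2)) => x y xy.
  rewrite -exprnP.
  set X2 := qbin _ _ _; set X3 := qbin _ _ _.
  set X4 := q ^ _; set X5 := q ^+ _.
  transitivity ((x * y) * X2 * X3 * X4 * X5 * (-1) ^ j); last by ring.
  by rewrite xy; ring.
rewrite (qbin_vandermonde_shift q1 q0); first last.
- by rewrite /p /s; have [j0|j0] := lerP j 0; [left|right]; nia.
- by rewrite /p /s; nia.
- by lia.
have ED : Delta%:Z = i%:Z + 1 by lia.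
by rewrite qbin_sym /c /p /s ED; congr (_ * qbin q _ _); ring.
Qed.

(** With i = m + k - s and d = 2s + Delta, the q-binomials regroup as [L, i] [i, m] [L-i, i+d-m].
    Vandermonde over m gives [L, i+d], and Vandermonde over i gives [2L, L-d]. *)
Lemma qtrin_sum (B L : nat) (s : int) : (L < B)%N -> 0 <= s \/ s <= - Delta%:Z ->
  \sum_(m < B) \sum_(k < B)
     q ^+ ((m + k) ^ 2 + k ^ 2 + Delta * (m + 2 * k))%N
     * qtrin q L%:Z m%:Z (2 * k + Delta)%N%:Z
     * qbin q (2 * k%:Z + Delta%:Z) (k%:Z - s)
  = q ^ (2 * s ^+ 2 + 2 * Delta%:Z * s)
     * qbin q (2 * L%:Z) (L%:Z - Delta%:Z - 2 * s).
Proof.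
move=> LB hs; pose d := 2 * s + Delta%:Z.
have := @qbin_vandermonde_shift _ _ q1 q0 L%:Z L%:Z 0 d B.
have -> : L%:Z + L%:Z = 2 * L%:Z by ring.
have -> : L%:Z + 0 - d = L%:Z - Delta%:Z - 2 * s by rewrite /d; ring.
move=> <-; [|lia..].
transitivity (q ^ (2 * s ^+ 2 + 2 * Delta%:Z * s) * \sum_(i < B) \sum_(m < B)
   q ^ ((i%:Z + 0) * (i%:Z + d)) * qbin q L%:Z (i%:Z + 0)
   * (q ^ ((i%:Z - m%:Z) * (i%:Z + d - m%:Z)) * qbin q i%:Z m%:Z
      * qbin q (L%:Z - i%:Z) (i%:Z + d - m%:Z))); last first.
  congr (_ * _); apply: eq_bigr => i _; rewrite -mulr_sumr.
  have [iL|iL] := leqP i L; last first.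
    by rewrite (@qbin_out _ _ _ (i%:Z + 0)) ?mulr0 ?mul0r //; lia.
  congr (_ * _); have -> : qbin q L%:Z (i%:Z + d) = qbin q (i + (L - i))%N%:Z (i%:Z + d).
    by congr (qbin q _ _); lia.
  rewrite -(qbin_vandermonde2 q1 q0) (_ : (L - i)%N%:Z = L%:Z - i%:Z); last by lia.
  pose f (m : int) := q ^ ((i%:Z - m) * (i%:Z + d - m)) * qbin q i%:Z m
      * qbin q (L%:Z - i%:Z) (i%:Z + d - m).
  apply: (@big_ord_supp _ f) => m m0.
  by rewrite /f !mulf_eq0 !negb_or -andbA => /and3P[_ /qbin_neq0 + _]; lia.
rewrite [in RHS]exchange_big /= mulr_sumr; apply: eq_bigr => m _.
pose f (i : int) := q ^ (2 * s ^+ 2 + 2 * Delta%:Z * s)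
   * (q ^ (i * (i + d)) * qbin q L%:Z i
   * (q ^ ((i - m%:Z) * (i + d - m%:Z)) * qbin q i m%:Z
      * qbin q (L%:Z - i) (i + d - m%:Z))).
have fs i : f i != 0 -> [/\ 0 <= i <= L%:Z, m%:Z <= i & 0 <= i + d - m%:Z <= L%:Z - i].
  rewrite /f !mulf_eq0 !negb_or -!andbA.
  move=> /and5P[_ _ /qbin_neq0 h1 _ /andP[/qbin_neq0 h2 /qbin_neq0 h3]].
  by split => //; lia.
transitivity (\sum_(i < B) f (0 + i%:Z)); last first.
  by rewrite mulr_sumr; apply: eq_bigr => i _; rewrite /f !add0r !addr0.
rewrite -fsum_range; last by move=> i /fs[]; lia.
(* Nonzero terms have k >= s and k >= -s - Delta; by [hs] this gives k >= 0, so the range 0 <= k < B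
   loses nothing. *)
rewrite (reindex_fsbigT (fun k => m%:Z - s + k)); last first.
  by exists (fun k => k - (m%:Z - s)) => k; ring.
rewrite (@fsum_range _ _ 0 B); last by move=> k /fs[]; rewrite /d; lia.
apply: eq_bigr => k _; rewrite /f add0r /qtrin.
set a := k%:Z - s; pose b := k%:Z + s + Delta%:Z.
have -> : m%:Z - s + k%:Z = m%:Z + a by rewrite /a; ring.
have -> : m%:Z + a + d - m%:Z = b by rewrite /a /b /d; ring.
have -> : m%:Z + a + d = m%:Z + b by rewrite /a /b /d; ring.
have -> : m%:Z + a - m%:Z = a by ring.
have Eab : (2 * k + Delta)%N%:Z = b + a by rewrite /a /b; lia.
have -> : 2 * k%:Z + Delta%:Z = b + a by rewrite /a /b; ring.
rewrite Eab exprnP.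
have -> : ((m + k) ^ 2 + k ^ 2 + Delta * (m + 2 * k))%N%:Z =
  2 * s ^+ 2 + 2 * Delta%:Z * s + (m%:Z + a) * (m%:Z + b) + a * b.
  rewrite /a /b.
  have -> : ((m + k) ^ 2 + k ^ 2 + Delta * (m + 2 * k))%N%:Z =
    (m%:Z + k%:Z) * (m%:Z + k%:Z) + k%:Z * k%:Z + Delta%:Z * (m%:Z + 2 * k%:Z).
    by lia.
  by ring.
rewrite !(expfzDr _ _ q0).
have R1 := qbin_mul_qbin q1 L%:Z (m%:Z + a) m%:Z.
have R2 := qbin_mul_qbin q1 (L%:Z - m%:Z) (b + a) a.
rewrite addrK in R2.
have E1 : m%:Z + a - m%:Z = a by ring.
rewrite E1 in R1.
have E2 : L%:Z - m%:Z - a = L%:Z - (m%:Z + a) by ring.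
rewrite E2 in R2.
set X1 := q ^ _ * q ^ _; set X2 := q ^ _; set X3 := q ^ _.
transitivity (X1 * X2 * X3 * qbin q L%:Z m%:Z *
  (qbin q (L%:Z - m%:Z) (b + a) * qbin q (b + a) a)); first by ring.
rewrite R2.
transitivity (X1 * X2 * X3 * (qbin q L%:Z m%:Z * qbin q (L%:Z - m%:Z) a)
  * qbin q (L%:Z - (m%:Z + a)) b); first by ring.
by rewrite -R1; ring.
Qed.

End Levels.

(** * Sums over tuples, one entry at a time *)

Lemma big_tuple0 (V : nmodType) (T : finType) (G : seq T -> V) :
  \sum_(s : 0.-tuple T) G s = G [::].
Proof.
rewrite (big_pred1 [tuple]) => // s /=.
by rewrite [s]tuple0; apply/esym/eqP.
Qed.

Lemma big_tuple_cons (V : nmodType) (T : finType) (w : nat) (G : seq T -> V) :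
  \sum_(s : w.+1.-tuple T) G s = \sum_x \sum_(s : w.-tuple T) G (x :: s).
Proof.
rewrite pair_big /= (reindex (fun p : T * w.-tuple T => [tuple of p.1 :: p.2])) //.
exists (fun s : w.+1.-tuple T => (thead s, [tuple of behead s])) => [[x s] _|s _] /=.
  by congr (_, _); apply: val_inj.
by rewrite [RHS]tuple_eta; apply: val_inj.
Qed.

Lemma sumn_drop (s : seq nat) (j : nat) :
  sumn (drop j s) = (\sum_(j <= t < size s) nth 0 s t)%N.
Proof.
rewrite sumnE (big_nth 0%N) size_drop -[in RHS](add0n j) big_addn.
by apply: eq_bigr => t _; rewrite nth_drop addnC.
Qed.

(** * The inner sum over n_1, ..., n_(v-1) in recursive form *)

Section Weight.
Variables (F : fieldType) (q : F).
Hypothesis q1 : forall i : nat, (0 < i)%N -> q ^+ i != 1.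
Variable Delta : nat.

(* The summand for (n_1, ..., n_(v-1)) = s, with K in place of k; the junk value
   at [::] is never reached. *)
Fixpoint weight (s : seq nat) (K : int) : F :=
  if s is n :: s' then
    q ^+ (sumn s ^ 2 + (size s <= Delta) * sumn s)%N
    * (if s' is [::] then qbin (q ^+ 2) K n%:Z
       else qbin q (n%:Z + 2 * (K - (sumn s)%:Z) + (minn Delta (size s'))%:Z) n%:Z
            * weight s' (K - (sumn s)%:Z))
  else 1.

(** The tail sums [sumn (drop j s)] are N_(j+1). Each recursive call lowers K by the current one,
    which accumulates the partial sums N_1 + ... + N_j in the q-binomials. *)
Lemma weightE (s : seq nat) (K : int) : s != [::] ->
  weight s K =
    q ^+ (\sum_(0 <= j < size s) (sumn (drop j s) ^ 2
            + (size s - j <= Delta) * sumn (drop j s)))%N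
    * qbin (q ^+ 2) (K - (\sum_(0 <= t < (size s).-1) sumn (drop t s))%N%:Z)
        (nth 0 s (size s).-1)%:Z
    * \prod_(0 <= j < (size s).-1)
        qbin q ((nth 0 s j)%:Z + 2 * K
                - 2 * (\sum_(0 <= t < j.+1) sumn (drop t s))%N%:Z
                + (minn Delta (size s - j.+1))%:Z)
          (nth 0 s j)%:Z.
Proof.
elim: s K => [//|n [_|n' s IH]] K _.
  by rewrite /= big_nat1 subn0 big_geq // subr0 big_geq // mulr1.
have {IH} := IH (K - (sumn [:: n, n' & s])%:Z) isT.
set s' := n' :: s; set N := sumn (n :: s').
have -> : weight (n :: s') K = q ^+ (N ^ 2 + (size (n :: s') <= Delta) * N)%N
  * (qbin q (n%:Z + 2 * (K - N%:Z) + (minn Delta (size s'))%:Z) n%:Z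
            * weight s' (K - N%:Z)) by [].
move=> ->; have [w Ew] : exists w, size s' = w.+1 by exists (size s).
clearbody s'; rewrite [size (n :: s')]/= Ew.
have -> : (\sum_(0 <= j < w.+2) (sumn (drop j (n :: s')) ^ 2
    + (w.+2 - j <= Delta) * sumn (drop j (n :: s')))
  = N ^ 2 + (w.+2 <= Delta) * N + \sum_(0 <= j < w.+1) (sumn (drop j s') ^ 2
    + (w.+1 - j <= Delta) * sumn (drop j s')))%N.
  by rewrite big_nat_recl // drop0 subn0; congr addn; apply: eq_bigr.
have EN j : (\sum_(0 <= t < j.+1) sumn (drop t (n :: s'))
  = N + \sum_(0 <= t < j) sumn (drop t s'))%N.
  by rewrite big_nat_recl // drop0.
rewrite [w.+2.-1]/= [w.+1.-1]/= !exprD EN [\prod_(0 <= _ < w.+1) _]big_nat_recl // EN.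
rewrite [\sum_(0 <= _ < 0) _]big_geq // addn0 subSS subn0.
rewrite (_ : n%:Z + 2 * K - 2 * N%:Z = n%:Z + 2 * (K - N%:Z)); last by ring.
rewrite (_ : K - (N + _)%N%:Z = K - N%:Z - (\sum_(0 <= t < w) sumn (drop t s'))%N%:Z);
  last by lia.
set P := \prod_(_ <= _ < _) _; set P' := \prod_(_ <= _ < _) _.
suff -> : P' = P by rewrite /=; ring.
apply: eq_bigr => j _.
by rewrite EN subSS; congr (qbin q (_ + _) _); rewrite /=; lia.
Qed.

Lemma weight_neq0 (s : seq nat) (K : int) : s != [::] ->
  weight s K != 0 -> (sumn s)%:Z <= K.
Proof.
elim: s K => [//|n [_|n' s IH]] K _.
  rewrite /= mulf_eq0 negb_or => /andP[_ /qbin_neq0]; lia.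
rewrite [weight _ _]/= -/(weight (n' :: s) _) mulf_eq0 negb_or.
move=> /andP[_]; rewrite mulf_eq0 negb_or => /andP[_ /(IH _ isT)].
by rewrite [sumn [:: n, n' & s]]/=; lia.
Qed.

Lemma weight_nseq0 (w : nat) : weight (nseq w.+1 0%N) 0 = 1.
Proof.
have q1' i : (0 < i)%N -> (q ^+ 2) ^+ i != 1.
  by move=> i0; rewrite -exprM q1 // muln_gt0.
elim: w => [|w IH]; first by rewrite /= muln0 expr0 mul1r (qbin0 q1' 0).
have E : weight (nseq w.+2 0%N) 0 = q ^+ (sumn (nseq w.+2 0) ^ 2
      + (w.+2 <= Delta) * sumn (nseq w.+2 0))%N
  * (qbin q (0 + 2 * (0 - (sumn (nseq w.+2 0%N))%:Z) + (minn Delta w.+1)%:Z) 0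
            * weight (nseq w.+1 0%N) (0 - (sumn (nseq w.+2 0%N))%:Z)).
  by rewrite /= size_nseq.
by rewrite E sumn_nseq mul0n muln0 subrr add0r IH (qbin0 q1) !mulr1.
Qed.

(** Passes from the variables n_j to the partial sums N_j: with M and r the sums of the tuple and of
    its tail, the head is M - r, and the recursion of [weight] becomes that of [fermi]. *)
Lemma weight_sum_eq (B w M : nat) (K : int) : (M < B)%N ->
  \sum_(s : w.+1.-tuple 'I_B | sumn (map val s) == M) weight (map val s) K
  = q ^+ (M ^ 2 + (w.+1 <= Delta) * M)%N * fermi q Delta w (K - M%:Z) M.
Proof.
elim: w M K => [|w IH] M K MB.
  rewrite big_mkcond /=.
  rewrite (big_tuple_cons _ (fun s : seq 'I_B =>
    if sumn (map val s) == M then weight (map val s) K else 0)).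
  under eq_bigr => x _ do rewrite (big_tuple0 (fun s => 
    if sumn (map val (x :: s)) == M then weight (map val (x :: s)) K else 0)).
  rewrite -big_mkcond (big_pred1 (Ordinal MB)) => [|x]; last first.
    by rewrite /= addn0 -val_eqE.
  by rewrite /= addn0 subrK.
rewrite big_mkcond /= (big_tuple_cons _ (fun s : seq 'I_B =>
    if sumn (map val s) == M then weight (map val s) K else 0)).
pose c (x : nat) := qbin q (x%:Z + 2 * (K - M%:Z) + (minn Delta w.+1)%:Z) x%:Z.
pose a := q ^+ (M ^ 2 + (w.+2 <= Delta) * M)%N.
transitivity (\sum_(r < M.+1) \sum_(x < B) \sum_(s : w.+1.-tuple 'I_B)
  if x == (M - r)%N :> nat then
   a * c x * (if sumn (map val s) == r then weight (map val s) (K - M%:Z) else 0)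
  else 0).
  rewrite [RHS]exchange_big; apply: eq_bigr => x _.
  rewrite [RHS]exchange_big; apply: eq_bigr => s _.
  have Ws : sumn (map val (x :: s)) = M -> weight (map val (x :: s)) K =
     a * c x * weight (map val s) (K - M%:Z).
    case: s => [[|y s] hs] //= E.
    have Es : size (map val s) = w by rewrite size_map; case/eqP: hs.
    by rewrite /a /c Es E; ring.
  case: eqP => [E|NE].
    have hr : (sumn (map val s) < M.+1)%N by move: E => /=; lia.
    rewrite Ws // (bigD1 (Ordinal hr)) //= eqxx big1 => [|r /eqP hr'].
      rewrite addr0; case: eqP => // nE; exfalso; apply: nE.
      by move: E => /=; lia.
    case: ifP => // _; case: eqP => [E'|]; last by rewrite mulr0.
    by exfalso; apply: hr'; apply: val_inj.
  rewrite big1 // => r _; case: eqP => // Ex; case: eqP => [Es|]; last by rewrite mulr0.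
  by exfalso; apply: NE; rewrite /= Es Ex subnK // -ltnS ltn_ord.
rewrite mulr_sumr; apply: eq_bigr => r _.
have hx : (M - r < B)%N by lia.
rewrite (bigD1 (Ordinal hx)) //= [X in _ + X]big1 => [|x /eqP hx']; last first.
  rewrite big1 // => s _; case: eqP => // E.
  by exfalso; apply: hx'; apply: val_inj.
rewrite addr0 eqxx -mulr_sumr -big_mkcond /= IH; last by have := ltn_ord r; lia.
rewrite /a /c; have -> : (M - r)%N%:Z = M%:Z - r%:Z by have := ltn_ord r; lia.
by ring.
Qed.

Lemma weight_sum (B w k : nat) : (k < B)%N ->
  \sum_(s : w.+1.-tuple 'I_B) weight (map val s) k%:Z
  = \sum_(M < k.+1) q ^+ (M ^ 2 + (w.+1 <= Delta) * M)%N
      * fermi q Delta w (k%:Z - M%:Z) M.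
Proof.
move=> kB.
under [RHS]eq_bigr => M _.
  rewrite -(@weight_sum_eq B); last by have := ltn_ord M; lia.
  rewrite big_mkcond.
  over.
rewrite exchange_big /=; apply: eq_bigr => s _; rewrite -big_mkcond /=.
have [->|nz] := eqVneq (weight (map val s) k%:Z) 0; first by rewrite big1.
have hs : (sumn (map val s) < k.+1)%N.
  have := weight_neq0 _ nz; rewrite -size_eq0 size_map size_tuple => /(_ isT); lia.
by rewrite (big_pred1 (Ordinal hs)) // => M; rewrite eq_sym.
Qed.

Lemma lhs_termE (v L m k : nat) (n : v.-1.-tuple nat) :
  (2 <= v)%N -> (Delta < v)%N ->
  lhs_term q Delta L (m, k, n) =
    q ^+ ((m + k) ^ 2 + k ^ 2 + Delta * (m + 2 * k))%N
    * qtrin q L%:Z m%:Z (2 * k + Delta)%N%:Z * weight n k%:Z.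
Proof.
move=> v2 Dv; rewrite weightE -?size_eq0 ?size_tuple; last by lia.
have NE j : Nsum n j.+1 = sumn (drop j n).
  by rewrite /Nsum big_add1 sumn_drop size_tuple.
rewrite /lhs_term /lhs_exponent.
have -> : (\sum_(1 <= j < v) Nsum n j ^ 2
   = \sum_(0 <= j < v.-1) sumn (drop j n) ^ 2)%N.
  by rewrite big_add1; apply: eq_bigr => j _; rewrite NE.
have -> : (\sum_(v - Delta <= t < v) Nsum n t
   = \sum_(0 <= j < v.-1) (v.-1 - j <= Delta) * sumn (drop j n))%N.
  (* After the shift to indices from 0, the sum starts at w = v - 1 - Delta, exactly where the
     indicator v - 1 - j <= Delta becomes true. *)
  have [w Ew] : exists w, (v - Delta = w.+1)%N by exists (v - Delta).-1; lia.
  rewrite Ew big_add1 [RHS](big_cat_nat (n := w)) //=; last by lia.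
  rewrite [X in _ = (X + _)%N]big_nat_cond [X in _ = (X + _)%N]big1 => [|j hj].
    rewrite add0n; apply: eq_big_nat => j hj.
    by rewrite NE (_ : (_ <= _)%N = true) ?mul1n //; lia.
  by rewrite (_ : (_ <= _)%N = false) ?mul0n //; lia.
rewrite -addnA -big_split /= exprD.
have -> : (\sum_(1 <= t < v.-1) Nsum n t
   = \sum_(0 <= t < v.-1.-1) sumn (drop t n))%N.
  by rewrite big_add1; apply: eq_bigr => j _; rewrite NE.
rewrite big_add1.
have -> : \prod_(0 <= i < v.-1.-1) qbin q
     ((nvar n i.+1)%:Z + 2 * k%:Z - 2 * (\sum_(1 <= t < i.+2) Nsum n t)%N%:Z +
      (minn Delta (v - 1 - i.+1))%:Z) (nvar n i.+1)%:Z
  = \prod_(0 <= j < v.-1.-1) qbin q ((nth 0 n j)%:Z + 2 * k%:Z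
                - 2 * (\sum_(0 <= t < j.+1) sumn (drop t n))%N%:Z
                + (minn Delta (v.-1 - j.+1))%:Z)
          (nth 0 n j)%:Z.
  apply: eq_bigr => j _; rewrite /nvar /= subn1 big_add1.
  by under [in LHS]eq_bigr => t _ do rewrite NE.
by rewrite /nvar; ring.
Qed.

End Weight.

(** * The case q = 0 *)

Lemma qbin_q0 (F : fieldType) (a b : int) :
  qbin (0 : F) a b = ((0 <= b) && (b <= a))%:R.
Proof.
have qp n : qpoch (0 : F) 0 n = 1.
  by rewrite /qpoch big1 // => i _; rewrite mul0r subr0.
by rewrite /qbin; case: ifP; rewrite // !qp mulr1 divr1.
Qed.

Lemma mem_leq_sumn (s : seq nat) x : x \in s -> (x <= sumn s)%N.
Proof.
elim: s => //= y s IH; rewrite inE => /predU1P[->|/IH]; lia.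
Qed.

Lemma lhs_term_neq0 (F : fieldType) (q : F) (v Delta L m k : nat)
    (n : v.-1.-tuple nat) :
  (2 <= v)%N -> (Delta < v)%N -> lhs_term q Delta L (m, k, n) != 0 ->
  [/\ (m <= L)%N, (k <= L)%N & (sumn n <= k)%N].
Proof.
move=> v2 Dv; rewrite lhs_termE // /qtrin mulf_eq0 negb_or => /andP[].
rewrite !mulf_eq0 !negb_or => /and3P[_ /qbin_neq0 h1 /qbin_neq0 h2].
move=> /weight_neq0; rewrite -size_eq0 size_tuple => h3.
by split; lia.
Qed.

(** A power of 0 survives only with exponent 0. On the left this forces m = k = 0, hence all n_j =
    0; on the right v j^2 + Delta j = 0 forces j = 0 because Delta < v. Both remaining terms are 1
    or 0 according to whether Delta <= L. *)
Lemma fsum_lhs_term_q0 (F : fieldType) (v Delta L : nat) :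
  (2 <= v)%N -> (Delta < v)%N ->
  \sum_(x \in [set: nat * nat * v.-1.-tuple nat]) lhs_term (0 : F) Delta L x =
  \sum_(j \in [set: int]) rhs_term (0 : F) v Delta L j.
Proof.
move=> v2 Dv; have q1 (i : nat) : (0 < i)%N -> (0 : F) ^+ i != 1.
  by move=> i0; rewrite expr0n gtn_eqF // eq_sym oner_neq0.
rewrite (@fsum_inj _ unit _
  (fun=> (0%N, 0%N, [tuple of nseq v.-1 0%N]))); first last.
- move=> [[m k] n] nz; exists tt.
  have [_ _ hn] := lhs_term_neq0 v2 Dv nz.
  move: nz; rewrite lhs_termE // !mulf_eq0 !negb_or -!andbA => /andP[+ _].
  rewrite expr0n; case: (@eqP nat _ 0%N) => [h _|_]; last by rewrite eqxx.
  have [m0 k0] : m = 0%N /\ k = 0%N by nia.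
  subst m k; congr (_, _, _); apply: val_inj => /=.
  rewrite -{1}(size_tuple n); apply/esym/all_pred1P/allP => x /mem_leq_sumn /=.
  by lia.
- by move=> [] [].
rewrite (@fsum_range _ _ 0 1); last first.
  move=> j; rewrite /rhs_term exp0rz !mulf_eq0 !negb_or -!andbA => /and3P[_ + _].
  case: (@eqP int _ 0) => [h _|_]; last by rewrite eqxx.
  suff : j = 0 by lia.
  by nia.
rewrite big_ord1 (big_pred1 tt) => [|[]//].
rewrite lhs_termE // /rhs_term (_ : 0 + _ = 0 :> int) //.
rewrite (_ : _ * 0 ^+ 2 + _ = 0); last by ring.
rewrite !expr0z !mul1r.
have -> : tval [tuple of nseq v.-1 0%N] = nseq v.-1.-1.+1 0%N.
  by rewrite prednK //; lia.
have -> : ((0 + 0) ^ 2 + 0 ^ 2 + Delta * (0 + 2 * 0) = 0)%N by lia.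
rewrite weight_nseq0 // mulr1 expr0 mul1r /qtrin !qbin_q0 -natrM mulnb.
by congr ((_ : bool)%:R); lia.
Qed.

(** * Combining the inner and outer summations *)

Theorem theorem1p1 (F : fieldType) (q : F) (v Delta L : nat) :
  (forall i : nat, (0 < i)%N -> q ^+ i != 1) ->
  (2 <= v)%N -> (Delta < v)%N ->
  \sum_(x \in [set: nat * nat * v.-1.-tuple nat]) lhs_term q Delta L x =
  \sum_(j \in [set: int]) rhs_term q v Delta L j.
Proof.
move=> q1 v2 Dv; have [->|q0] := eqVneq q 0; first exact: fsum_lhs_term_q0.
have [w Ev] : exists w, v = w.+2 by exists v.-2; lia.
subst v; pose B := L.+1.
have rs j : rhs_term q w.+2 Delta L j != 0 -> - B%:Z < j < B%:Z.
  by rewrite /rhs_term !mulf_eq0 !negb_or => /andP[_ /qbin_neq0]; rewrite /B; nia.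
rewrite -(@sumZ_fsum _ B) => [|j /rs]; last by lia.
(* The closed form of the inner sum carries -Delta j in its exponent, so its j corresponds to -j on
   the right-hand side. *)
rewrite (sumZ_opp rs).
pose h (x : 'I_B * 'I_B * w.+1.-tuple 'I_B) : nat * nat * w.+1.-tuple nat :=
  (val x.1.1, val x.1.2, map_tuple val x.2).
rewrite (@fsum_inj _ _ _ h); first last.
- move=> [[m k] n] /(lhs_term_neq0 v2 Dv)[hm hk hn].
  exists (inord m, inord k, map_tuple inord n); rewrite /h /= !inordK //.
  congr (_, _, _); apply: val_inj => /=.
  rewrite -map_comp -[RHS]map_id; apply/eq_in_map => x /mem_leq_sumn hx /=.
  by rewrite inordK // ltnS (leq_trans hx) // (leq_trans hn).
- move=> [[m k] n] [[m' k'] n'] [/val_inj -> /val_inj -> /(inj_map val_inj) hn].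
  by congr (_, _, _); apply: val_inj.
pose a (m k : nat) := q ^+ ((m + k) ^ 2 + k ^ 2 + Delta * (m + 2 * k))%N
    * qtrin q L%:Z m%:Z (2 * k + Delta)%N%:Z.
transitivity (\sum_(m < B) \sum_(k < B) \sum_(s : w.+1.-tuple 'I_B)
   a m k * weight q Delta (map val s) k%:Z).
  rewrite pair_big pair_big /=; apply: eq_bigr => [[[m k] s]] _.
  exact: lhs_termE.
pose c (k : nat) (j : int) := (-1) ^ j * q ^ ((w%:Z + 2) * j ^+ 2 - Delta%:Z * j)
       * qbin q (2 * k%:Z + Delta%:Z) (k%:Z + (w%:Z + 2) * j).
transitivity (\sum_(m < B) \sum_(k < B) sumZ B (fun j => a m k * c k j)).
  apply: eq_bigr => m _; apply: eq_bigr => k _.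
  by rewrite -mulr_sumr weight_sum // (@fermi_sum _ _ q1 q0 _ B) ?sumZM //; lia.
under eq_bigr => m _ do rewrite sumZ_sum.
rewrite sumZ_sum; apply: eq_sumZ => j.
pose e := (-1) ^ j * q ^ ((w%:Z + 2) * j ^+ 2 - Delta%:Z * j) : F.
(* [qtrin_sum] is used with s = -v j; as j is an integer and Delta < v, s cannot lie strictly
   between -Delta and 0. *)
have hj : 0 <= - ((w%:Z + 2) * j) \/ - ((w%:Z + 2) * j) <= - Delta%:Z.
  by have [|] := lerP j 0; [left|right]; nia.
have := @qtrin_sum _ _ q1 q0 Delta B L _ (ltnSn L) hj.
rewrite opprK; set R := (X in _ = X) => H.
transitivity (e * R).
  rewrite -H.
  rewrite mulr_sumr; apply: eq_bigr => m _; rewrite mulr_sumr.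
  by apply: eq_bigr => k _; rewrite /a /c /e; ring.
rewrite /e /R /rhs_term signzN mulrA; congr (_ * qbin q _ _); last by lia.
rewrite -[LHS]mulrA -(expfzDr _ _ q0); congr (_ * q ^ _).
have -> : w.+2%:Z = w%:Z + 2 by lia.
by ring.
Qed.
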